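(* Let $X$ be a Helly graph. The following two graphs are naturally isomorphic: \begin{itemize} \item the graph with vertex set $E(X)\cap\left(\tfrac12\mathbb{N}\right)^X$, with an edge between $f$ and $g$ if and only if $d_\infty(f,g)=\frac12$; \item the graph with vertex set $$\{\text{round cliques of }X\} = X \cup \{\text{non-empty intersections of maximal cliques of }X\},$$ with an edge between $\sigma$ and $\tau$ if and only if $\sigma\cap\tau\neq\emptyset$ and $\sigma\cup\tau$ is a clique of $X$ \end{itemize} (in particular the displayed equality of sets holds). This graph is the first Helly subdivision $X'$ of $X$, and the natural map $X\to X'$, $x\mapsto d(x,\cdot)$, is a $2$-homothetic embedding (i.e. distances in the graph $X'$ are twice the distances in $X$ between images of vertices of $X$).
   Context: A graph is identified with its vertex set, with graph metric $d$ (edges of length $1$); $B(x,r)=\{y: d(x,y)\le r\}$. A connected graph is Helly if every family of pairwise intersecting combinatorial balls has non-empty intersection. A clique is the (non-empty) vertex set of a complete subgraph; a clique is round if it is an intersection of balls of $X$; vertices of $X$ are viewed as singleton cliques. The injective hull: $E(X)=\{f:X\to\mathbb{R} \mid f(x)+f(y)\ge d(x,y)\ \forall x,y,\ f(x)=\sup_y (d(x,y)-f(y))\ \forall x\}$ with the sup metric $d_\infty$. The first Helly subdivision is $X'=\{p\in E(X): p(x)\in\frac12\mathbb{N}\ \forall x\in X\}$. *)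

(* Defs.v *)
From mathcomp Require Import all_boot all_order all_algebra.
From mathcomp Require Import all_classical all_reals.

Set Implicit Arguments.
Unset Strict Implicit.
Unset Printing Implicit Defensive.
Import Order.TTheory GRing.Theory Num.Theory.
Local Open Scope classical_set_scope.
Local Open Scope ring_scope.

(* Simple graphs, on a possibly infinite vertex type. *)
Record graph := Graph {
  vertex :> Type;
  adj : rel vertex;
  adj_sym : symmetric adj;
  adj_irr : irreflexive adj }.

Definition graph_iso (X Y : graph) (phi : X -> Y) : Prop :=
  bijective phi /\ forall x y, adj (phi x) (phi y) = adj x y.

Section Graph.
Variable X : graph.

Definition walk (n : nat) (x y : X) : Prop :=
  exists p : seq X, [/\ path (@adj X) x p, last x p = y & size p = n].

(* Equal to 0 by convention when no walk joins x to y. *)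
Definition gdist (x y : X) : nat :=
  xget 0%N [set n | walk n x y /\ forall m, walk m x y -> (n <= m)%N].

Definition connected_graph : Prop :=
  [set: X] !=set0 /\ forall x y : X, exists n, walk n x y.

Definition gball (x : X) (r : nat) : set X := [set y | (gdist x y <= r)%N].

Definition is_ball (B : set X) : Prop := exists x r, B = gball x r.

Definition helly_graph : Prop :=
  connected_graph /\
  forall F : set (set X), F `<=` is_ball ->
    (forall A B, F A -> F B -> A `&` B !=set0) ->
    \bigcap_(B in F) B !=set0.

Definition clique (s : set X) : Prop :=
  s !=set0 /\ forall x y, s x -> s y -> x <> y -> adj x y.

Definition max_clique (s : set X) : Prop :=
  clique s /\ forall t, clique t -> s `<=` t -> t = s.

Definition round_cliques : set (set X) :=
  [set s | clique s /\
    exists2 F : set (set X), F `<=` is_ball & s = \bigcap_(B in F) B].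

(* The family is required non-empty, as the empty intersection is all of X. *)
Definition max_clique_intersections : set (set X) :=
  [set s | s !=set0 /\
    exists F : set (set X),
      [/\ F !=set0, F `<=` max_clique & s = \bigcap_(t in F) t]].

(* Since the graph is simple, s <> t excludes the loops that the other two
   conditions would allow. *)
Definition round_clique_adj : rel (set_type round_cliques) := fun s t =>
  `[< [/\ s <> t, \val s `&` \val t !=set0 & clique (\val s `|` \val t)] >].

Lemma round_clique_adj_sym : symmetric round_clique_adj.
Proof.
by move=> s t; apply/asboolP/asboolP => -[st]; rewrite setIC setUC; split=> // /esym.
Qed.

Lemma round_clique_adj_irr : irreflexive round_clique_adj.
Proof. by move=> s; apply/asboolP => -[]. Qed.

Definition round_clique_graph : graph :=
  Graph round_clique_adj_sym round_clique_adj_irr.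

End Graph.

Arguments round_cliques : clear implicits.
Arguments max_clique_intersections : clear implicits.

Section Hull.
Variables (R : realType) (X : graph).

Definition kuratowski (x : X) : X -> R := fun y => (gdist x y)%:R.

(* The first condition bounds d(x, y) - f(y) by f(x), so the real-valued sup
   is a genuine supremum as soon as X is non-empty. *)
Definition injective_hull : set (X -> R) :=
  [set f | (forall x y, (gdist x y)%:R <= f x + f y) /\
           (forall x, f x = sup [set (gdist x y)%:R - f y | y in [set: X]])].

(* Only meaningful when f - g is bounded, as it is for f and g in
   [injective_hull] with X connected. *)
Definition dinf (f g : X -> R) : R := sup [set `|f x - g x| | x in [set: X]].

Definition half_integral : set (X -> R) :=
  [set f | forall x, exists n : nat, f x = n%:R / 2].

Definition subdivision_adj :
    rel (set_type (injective_hull `&` half_integral)) :=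
  fun f g => dinf (\val f) (\val g) == 2^-1.

Lemma subdivision_adj_sym : symmetric subdivision_adj.
Proof.
move=> f g; rewrite /subdivision_adj; congr (_ == _).
by congr (sup _); apply/seteqP; split=> _ [x _ <-]; exists x => //; exact: distrC.
Qed.

Lemma subdivision_adj_irr : irreflexive subdivision_adj.
Proof.
move=> f; apply/negbTE/eqP => h.
have : (2^-1 : R) = 0.
  rewrite -h /dinf.
  have [[x _]|/nonemptyPn X0] := pselect ([set: X] !=set0).
    rewrite -[RHS](@sup1 R 0); congr (sup _); apply/seteqP.
    by split=> [_ [y _ <-]|_ ->]; [|exists x => //]; rewrite subrr normr0.
  by rewrite X0 image_set0 sup0.
by apply/eqP; rewrite invr_eq0 pnatr_eq0.
Qed.

Definition helly_subdivision : graph :=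
  Graph subdivision_adj_sym subdivision_adj_irr.

End Hull.

(* Main.v *)
Require Import Defs.
From mathcomp Require Import all_boot all_order all_algebra.
From mathcomp Require Import all_classical all_reals.
From mathcomp Require Import zify lra.

Set Implicit Arguments.
Unset Strict Implicit.
Unset Printing Implicit Defensive.
Import Order.TTheory GRing.Theory Num.Theory.
Local Open Scope classical_set_scope.
Local Open Scope ring_scope.

(* Write [f = F / 2] with [F] natural-valued, and let [s] be the set of vertices
   where [F <= 1], that is, those within [1/2] of [f].  The Helly property,
   applied to the balls [B(w, ceil (f w))] and [B(y, floor (f y))], shows that the
   minimum and the maximum of [d(y, .)] on [s] are [floor (f y)] and [ceil (f y)];
   hence [F y] is their sum and [s] determines [f].  Conversely, for a round
   clique [s] the sum of this minimum and maximum is twice a point of the hull.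
   A round clique [s] that is not a vertex is an intersection of maximal cliques:
   if [w] lies outside a ball [B(x, r)] containing [s] and is adjacent to all of
   [s], then [s] lies on the sphere of radius [r] about [x], and the Helly
   property gives a vertex of [B(x, r - 1)] adjacent to all of [s], hence not to
   [w]. *)

(** * Walks and shortest walks *)

Section Walks.
Local Open Scope nat_scope.
Variable X : graph.
Implicit Types x y z : X.

Lemma walk_gdist n x y : walk n x y -> walk (gdist x y) x y.
Proof.
elim/ltn_ind: n => n IH w.
have [min|] := pselect (forall m, walk m x y -> n <= m).
  by rewrite /gdist; case: xgetP => [k -> [] //|/(_ n)]; case; split.
by move=> /existsNP[m /not_implyP[wm /negP]]; rewrite -ltnNge => /IH; apply.
Qed.

Lemma gdist_le n x y : walk n x y -> gdist x y <= n.
Proof.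
move=> w; have := walk_gdist w; rewrite /gdist.
by case: xgetP => [k -> [_ h] _|//]; exact: h.
Qed.

Lemma gdist_eq n x y :
  walk n x y -> (forall m, walk m x y -> n <= m) -> gdist x y = n.
Proof. by move=> w min; apply/eqP; rewrite eqn_leq gdist_le//; exact/min/(walk_gdist w). Qed.

Lemma walk0 x : walk 0 x x.
Proof. by exists [::]. Qed.

Lemma walk1 x y : adj x y -> walk 1 x y.
Proof. by move=> xy; exists [:: y]; rewrite /= xy. Qed.

Lemma walk0_eq x y : walk 0 x y -> x = y.
Proof. by move=> [p [_ <- /size0nil ->]]. Qed.

Lemma adj_walk1 x y : walk 1 x y -> adj x y.
Proof. by move=> [[|u [|v p]] []//=]; rewrite andbT => xu <-. Qed.

Lemma walk_cat m n x y z : walk m x y -> walk n y z -> walk (m + n) x z.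
Proof.
move=> [p [px <- <-]] [q [qy <- <-]]; exists (p ++ q).
by rewrite cat_path px qy last_cat size_cat.
Qed.

Lemma walk_split m n x z :
  walk (m + n) x z -> exists2 y, walk m x y & walk n y z.
Proof.
move=> [p [px pz sp]]; exists (last x (take m p)).
  exists (take m p); split=> //.
    by move: px; rewrite -{1}(cat_take_drop m p) cat_path => /andP[].
  by rewrite size_takel// sp leq_addr.
exists (drop m p); split.
- by move: px; rewrite -{1}(cat_take_drop m p) cat_path => /andP[].
- by rewrite -last_cat cat_take_drop.
- by rewrite size_drop sp addKn.
Qed.

Lemma walk_sym n x y : walk n x y -> walk n y x.
Proof.
elim: n x y => [|n IH] x y; first by move=> /walk0_eq ->; exact: walk0.
rewrite -{1}add1n => /walk_split[z /adj_walk1 xz /IH yz].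
by rewrite -addn1; apply: (walk_cat yz); apply: walk1; rewrite adj_sym.
Qed.

End Walks.

(** * The path metric of a connected graph *)

Section Metric.
Local Open Scope nat_scope.
Variable X : graph.
Hypothesis conn : connected_graph X.
Implicit Types x y z : X.

Let gwalk x y : walk (gdist x y) x y.
Proof. by case: conn => _ /(_ x y)[n]; exact: walk_gdist. Qed.

Lemma gdistxx x : gdist x x = 0.
Proof. by apply/eqP; rewrite -leqn0 gdist_le //; exact: walk0. Qed.

Lemma gdist0_eq x y : gdist x y = 0 -> x = y.
Proof. by move=> d0; apply: walk0_eq; rewrite -d0. Qed.

Lemma gdistC x y : gdist x y = gdist y x.
Proof.
by apply/eqP; rewrite eqn_leq !gdist_le//; apply: walk_sym; exact: gwalk.
Qed.

Lemma gdist_triangle y x z : gdist x z <= gdist x y + gdist y z.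
Proof. by apply: gdist_le; apply: walk_cat; exact: gwalk. Qed.

(** Turns the pairwise clause of [clique] into a diameter bound. *)
Lemma gdist_le1 x y : (x <> y -> adj x y) <-> gdist x y <= 1.
Proof.
split=> [xy|].
  have [<-|/xy/walk1/gdist_le//] := pselect (x = y).
  by rewrite gdistxx.
case: (posnP (gdist x y)) => [/gdist0_eq//|d0 d1 _].
have d2: gdist x y = 1 by lia.
by apply: adj_walk1; rewrite -d2.
Qed.

Lemma gball_meet x y r s :
  gdist x y <= r + s -> gball x r `&` gball y s !=set0.
Proof.
(* Split a shortest walk at distance [r] from [x]; if [r] exceeds [d(x, y)], then [y] itself lies in
   both balls. *)
move=> h; have [le|/ltnW le] := leqP r (gdist x y).
  have := gwalk x y; rewrite -(subnKC le).
  move=> /walk_split[z /gdist_le xz /gdist_le zy]; exists z; split=> //=.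
  by rewrite /gball /= gdistC; lia.
by exists y; split; rewrite /gball /= ?gdistxx.
Qed.

Lemma cliqueE (s : set X) :
  clique s <-> s !=set0 /\ forall x y, s x -> s y -> gdist x y <= 1.
Proof.
split=> -[s0 h]; split=> // x y sx sy; first by apply/gdist_le1; exact: h.
by apply/gdist_le1; exact: h.
Qed.

End Metric.

(** * Round cliques and doubled hull functions in a Helly graph *)

Section Helly.
Local Open Scope nat_scope.
Variable X : graph.
Hypothesis hX : helly_graph X.
Implicit Types (x y z : X) (s t : set X) (F G : X -> nat).

Let conn : connected_graph X := proj1 hX.

(** A family of balls is encoded as a relation between centres and radii, which turns pairwise
    intersection into an inequality. *)
Lemma helly_point (D : X -> nat -> Prop) :
    (forall x r y k, D x r -> D y k -> gdist x y <= r + k) ->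
  exists z, forall x r, D x r -> gdist x z <= r.
Proof.
move=> DD; case: hX => _ /(_ [set B | exists x r, D x r /\ B = gball x r]) [].
- by move=> B [x [r [_ ->]]]; exists x, r.
- move=> A B [x [r [xr ->]]] [y [k [yk ->]]].
  by apply: gball_meet => //; exact: DD.
- by move=> z hz; exists z => x r xr; apply: (hz (gball x r)); exists x, r.
Qed.

Lemma round_cliqueP s : round_cliques X s <->
  clique s /\
  forall z, (forall x r, s `<=` gball x r -> gball x r z) -> s z.
Proof.
split=> -[cs].
  move=> [B Bball sE]; split=> // z hz; rewrite sE => A BA.
  have [x [r Axr]] := Bball _ BA; rewrite Axr; apply: hz.
  by rewrite -Axr sE => u; apply.
move=> h; split=> //; exists [set B | is_ball B /\ s `<=` B]; first by move=> B [].
apply/seteqP; split=> z.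
  by move=> sz B [_]; apply.
by move=> hz; apply: h => x r sxr; apply: hz; split=> //; exists x, r.
Qed.

(** The Helly property applies to [B(y, k)] together with all balls containing [s]; roundness puts
    the common point in [s]. *)
Lemma round_clique_meet s y k : round_cliques X s ->
    (forall x r, s `<=` gball x r -> gdist x y <= r + k) ->
  exists2 z, s z & gdist y z <= k.
Proof.
move=> /round_cliqueP[[[u su] _] rs] h.
have [|z hz] := @helly_point (fun x r => s `<=` gball x r \/ x = y /\ r = k).
  move=> x r x' r' [sx|[-> ->]] [sx'|[-> ->]].
  - have := sx _ su; have := sx' _ su; rewrite /gball /= => h1 h2.
    by have := gdist_triangle conn u x x'; rewrite (gdistC conn u x'); lia.
  - exact: h.
  - by have := h _ _ sx'; rewrite gdistC// addnC.
  - by rewrite gdistxx.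
exists z; last by apply: hz; right.
by apply: rs => x r sx; apply: hz; left.
Qed.

(* For [F = 2 f] these are the two conditions defining the injective hull; the
   supremum is attained because the values are half-integers. *)
Definition half_hull F : Prop :=
  (forall x y, 2 * gdist x y <= F x + F y) /\
  (forall x, exists y, F x + F y = 2 * gdist x y).

Definition core F : set X := [set x | F x <= 1].

Definition spread F s : Prop := forall y,
  [/\ (forall z, s z -> (F y)./2 <= gdist y z <= uphalf (F y)),
      (exists2 z, s z & gdist y z = (F y)./2) &
      (exists2 z, s z & gdist y z = uphalf (F y))].

Lemma spread_inj F G s : spread F s -> spread G s -> F = G.
Proof.
move=> Fs Gs; apply/funext => y.
have [F1 [a sa Fa] [b sb Fb]] := Fs y; have [G1 [c sc Gc] [d sd Gd]] := Gs y.
by have := F1 _ sc; have := F1 _ sd; have := G1 _ sa; have := G1 _ sb; lia.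
Qed.

(** Triangle inequality through a vertex [z] antipodal to [x], that is, with
    [F x + F z = 2 d(x, z)]. *)
Lemma half_hull_lip F x y : half_hull F -> F x <= F y + 2 * gdist y x.
Proof.
move=> [h1 h2]; have [z xz] := h2 x; have := h1 y z.
by have := gdist_triangle conn y x z; rewrite (gdistC conn x y); lia.
Qed.

(** Exhibits the core as an intersection of balls. From right to left, the bound is tested at a
    vertex antipodal to [z]. *)
Lemma core_ball F z :
  half_hull F -> core F z <-> forall y, gdist y z <= uphalf (F y).
Proof.
move=> [h1 h2]; rewrite /core /=; split=> [Fz y|h].
  by have := h1 y z; lia.
by have [w] := h2 z; rewrite gdistC//; have := h w; lia.
Qed.

Lemma core_round F : half_hull F -> round_cliques X (core F).
Proof.
move=> hF; have [h1 _] := hF; apply/round_cliqueP; split.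
  apply/cliqueE => //; split.
    have [|z hz] := @helly_point (fun x r => r = uphalf (F x)).
      by move=> x _ y _ -> ->; have := h1 x y; lia.
    by exists z; apply/core_ball => // y; exact: hz.
  by move=> x y; rewrite /core /=; have := h1 x y; lia.
move=> z hz; apply/core_ball => // y; apply: hz => u /core_ball.
by move=> /(_ hF); apply.
Qed.

Lemma core_spread F : half_hull F -> spread F (core F).
Proof.
move=> hF; have [h1 h2] := hF.
have bd y z : core F z -> (F y)./2 <= gdist y z <= uphalf (F y).
  move=> Fz; move/(core_ball _ hF): (Fz) => -> ; rewrite andbT.
  by have := half_hull_lip y z hF; move: Fz; rewrite /core /= gdistC//; lia.
have near y : exists2 z, core F z & gdist y z = (F y)./2.
  (* Adding the smaller ball [B(y, floor (f y))] keeps the family pairwise intersecting, because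
     distances are integers. *)
  have [|z hz] := @helly_point (fun x r => r = uphalf (F x) \/ x = y /\ r = (F y)./2).
    move=> x r x' r' [->|[-> ->]] [->|[-> ->]].
    - by have := h1 x x'; lia.
    - by have := h1 x y; lia.
    - by have := h1 y x'; lia.
    - by rewrite gdistxx.
  have Fz : core F z by apply/core_ball => // x; apply: hz; left.
  exists z => //; have := bd y _ Fz; have : gdist y z <= (F y)./2 by apply: hz; right.
  lia.
move=> y; split=> //; first by move=> z; exact: bd.
(* For the maximum, take the point of the core nearest to an antipode [w] of [y]: its distance to
   [y] is at least [F y / 2]. *)
have [w yw] := h2 y; have [z Fz wz] := near w; exists z => //.
have := bd y _ Fz; have := gdist_triangle conn z y w.
by rewrite (gdistC conn z w); lia.
Qed.

(** * From round cliques back to hull functions *)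

Lemma clique_spread s : clique s -> exists F, spread F s.
Proof.
move=> /(cliqueE conn)[[u su] cs].
suff: forall y, exists n, [/\ (forall z, s z -> n./2 <= gdist y z <= uphalf n),
      (exists2 z, s z & gdist y z = n./2) &
      (exists2 z, s z & gdist y z = uphalf n)].
  by move=> /choice[F hF]; exists F.
move=> y.
have [m [a sa am] mmin] : exists2 m, (exists2 a, s a & gdist y a = m) &
    forall z, s z -> m <= gdist y z.
  move: {2}(gdist y u) (leqnn (gdist y u)) => n.
  elim: n => [|n IH] in u su *; first by move=> h; exists (gdist y u) => [|z _]; [exists u|lia].
  move=> un; have [h|] := pselect (forall z, s z -> gdist y u <= gdist y z).
    by exists (gdist y u) => //; exists u.
  move=> /existsNP[z /not_implyP[sz h]]; apply: (IH z) => //.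
  lia.
have le z : s z -> gdist y z <= m.+1.
  by move=> sz; have := gdist_triangle conn a y z; have := cs _ _ sa sz; lia.
(* Distances from [y] to a clique take at most the values [m] and [m + 1]; [F y] is [2m + 1] if both
   occur and [2m] otherwise. *)
have [[b sb bm]|no] := pselect (exists2 b, s b & gdist y b = m.+1).
  exists (2 * m).+1; split.
  - by move=> z sz; have := le _ sz; have := mmin _ sz; lia.
  - by exists a => //; lia.
  - by exists b => //; lia.
exists (2 * m); split.
- move=> z sz; have := le _ sz; have := mmin _ sz.
  have : gdist y z <> m.+1 by move=> h; apply: no; exists z.
  lia.
- by exists a => //; lia.
- by exists a => //; lia.
Qed.

Lemma spread_core F s : clique s -> spread F s -> core F = s.
Proof.
move=> /(cliqueE conn)[_ cs] Fs; apply/seteqP; split=> x; rewrite /core /=.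
  move=> Fx; have [_ [z sz xz] _] := Fs x.
  by rewrite (_ : x = z)//; apply: (gdist0_eq conn); lia.
move=> sx; have [h _ [z sz xz]] := Fs x.
have := h _ sx; have := cs _ _ sx sz; rewrite gdistxx; lia.
Qed.

Lemma spread_half_hull F s : round_cliques X s -> spread F s -> half_hull F.
Proof.
move=> rs Fs; have [cs _] := (round_cliqueP s).1 rs.
have [_ cs1] := (cliqueE conn s).1 cs.
split=> [x y|x].
  (* Passing through the nearest points [a] to [x] and [b] to [y] bounds [d(x, y)] by a minimum plus
     a maximum in both orders; the two bounds add up to [F x + F y]. *)
  have [hx [a sa xa] _] := Fs x; have [hy [b sb yb] _] := Fs y.
  have := hx _ sb; have := hy _ sa.
  have := gdist_triangle conn a x y; have := gdist_triangle conn b x y.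
  by rewrite (gdistC conn a y) (gdistC conn b y); lia.
have [hx [a sa xa] [b sb xb]] := Fs x.
have [eq|ne] := eqVneq (F x)./2 (uphalf (F x)); last first.
  (* [x] sees two distances to [s]: a point of [s] far from [x] is antipodal. *)
  exists b; have [hb _ [c sc bc]] := Fs b.
  have := hb _ sb; have := cs1 _ _ sb sc; rewrite gdistxx// => bc1 b0.
  have := hb _ sa; have := gdist_triangle conn a x b.
  by rewrite (gdistC conn a b); lia.
have [x0|x1] := posnP (F x); first by exists x; rewrite gdistxx; lia.
(* [s] lies on a sphere about [x], so the smaller ball about [x] misses [s] and
   by the Helly property it misses one of the balls cutting out [s]. *)
have [|/existsNP[y /existsNP[r /not_implyP[sy /negP yr]]]] :=
    pselect (forall y r, s `<=` gball y r -> gdist y x <= r + (uphalf (F x)).-1).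
  by move=> /(round_clique_meet rs)[z sz xz]; have := hx _ sz; lia.
exists y; have [_ [c sc yc] [d sd yd]] := Fs y.
(* All of [s] is at distance [F x / 2] from [x], and [d(x, y) >= r + F x / 2], so no point of [s] is
   nearer to [y] than [r]. Hence [F y = 2 r], and [y] is antipodal to [x]. *)
have far z : s z -> gdist y z = r.
  move=> sz; have := hx _ sz; have := sy _ sz; rewrite /gball /=.
  by have := gdist_triangle conn z y x; rewrite (gdistC conn z x); lia.
have := far _ sc; have := far _ sd; have := far _ sa.
have := gdist_triangle conn a x y; rewrite (gdistC conn a y) (gdistC conn x y).
lia.
Qed.

(** * Adjacency in terms of cores *)

Lemma half_hull_close F G : half_hull F -> half_hull G ->
  (forall y, F y <= (G y).+1 /\ G y <= (F y).+1) <->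
  core F `&` core G !=set0 /\ clique (core F `|` core G).
Proof.
move=> hF hG; have [F1 _] := hF; have [G1 _] := hG; split=> [FG|].
  have [|z hz] :=
      @helly_point (fun x r => r = uphalf (F x) \/ r = uphalf (G x)).
    move=> x r x' r' hr hr'; have := F1 x x'; have := G1 x x'.
    by have := FG x; have := FG x'; case: hr hr' => -> [] ->; lia.
  have [Fz Gz] : core F z /\ core G z.
    by split; apply/core_ball => // y; apply: hz; [left|right].
  split; first by exists z.
  apply/(cliqueE conn); split; first by exists z; left.
  rewrite /core => x y /= hx hy; have := F1 x y; have := G1 x y.
  by have := FG x; have := FG y; lia.
(* The clique condition bounds the maximum for one core by the minimum for the other plus 1; the
   common vertex [z0] excludes the remaining case, two even values differing by 2. *)
move=> [[z0 [Fz0 Gz0]] /(cliqueE conn)[_ cFG]] y.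
have [Fy [a Fa ya] [b Fb yb]] := core_spread hF y.
have [Gy [c Gc yc] [d Gd yd]] := core_spread hG y.
have := Fy _ Fz0; have := Gy _ Gz0.
have := cFG b c (or_introl Fb) (or_intror Gc).
have := cFG a d (or_introl Fa) (or_intror Gd).
have := gdist_triangle conn c y b; have := gdist_triangle conn a y d.
by rewrite (gdistC conn c b); lia.
Qed.

(** * Vertices and edges as sources of round cliques *)

Lemma half_hull_gdist x : half_hull (fun y => 2 * gdist x y).
Proof.
split=> [y z|y]; first by have := gdist_triangle conn x y z; rewrite (gdistC conn y x); lia.
by exists x; rewrite gdistxx// (gdistC conn y x); lia.
Qed.

Lemma core_gdist x : core (fun y => 2 * gdist x y) = [set x].
Proof.
apply/seteqP; split=> [y|_ ->]; rewrite /core /= ?gdistxx// => h.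
by apply/esym/(gdist0_eq conn); lia.
Qed.

Lemma round_clique1 x : round_cliques X [set x].
Proof. by rewrite -core_gdist; apply: core_round; exact: half_hull_gdist. Qed.

Lemma round_clique_edge x y :
  gdist x y <= 1 -> exists s, [/\ round_cliques X s, s x & s y].
Proof.
(* [x] and [y] are in the unit ball about each [u] in [s], hence so is [s]. *)
move=> xy; set s := [set z | forall v r,
  gdist v x <= r -> gdist v y <= r -> gdist v z <= r].
have [sx sy] : s x /\ s y by split.
exists s; split=> //; apply/round_cliqueP; split; last first.
  move=> z hz v r vx vy; apply: (hz v r) => u; exact.
apply/(cliqueE conn); split; first by exists x.
move=> u v su; apply; rewrite (gdistC conn u); apply: su;
  by rewrite ?gdistxx// (gdistC conn y).
Qed.

(** * Round cliques as intersections of maximal cliques *)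

Lemma max_clique_ex s : clique s -> exists2 t, max_clique t & s `<=` t.
Proof.
(* Zorn's lemma runs over the sets whose union with [s] is a clique, so that the empty chain, with
   empty union, is covered too. *)
move=> cs; have [|t [st ht]] := @Zorn_bigcup X (fun t => clique (s `|` t)).
  move=> F Fc Ftot; apply/(cliqueE conn); split.
    by have [u su] := cs.1; exists u; left.
  have sT t x y : clique (s `|` t) -> (s `|` t) x -> (s `|` t) y -> gdist x y <= 1.
    by move=> /(cliqueE conn)[_]; apply.
  have cs1 x y : s x -> s y -> gdist x y <= 1.
    by move=> sx sy; apply: (sT set0); rewrite ?setU0.
  move=> x y [sx|[A FA Ax]] [sy|[B FB By]]; first exact: cs1.
  - by apply: (sT B); [exact: Fc|left|right].
  - by apply: (sT A); [exact: Fc|right|left].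
  - have [AB|BA] := Ftot _ _ FA FB.
      by apply: (sT B); [exact: Fc|right; exact: AB|right].
    by apply: (sT A); [exact: Fc|right|right; exact: BA].
exists (s `|` t); last exact: subsetUl.
split=> // u cu stu; apply/seteqP; split=> //.
have su : s `<=` u by move=> z sz; apply: stu; left.
have [tu|/existsNP[z /not_implyP[uz ntz]]] := pselect (u `<=` t).
  by move=> z /tu; right.
have := ht u; rewrite (_ : s `|` u = u); last by apply/setUidPr.
case=> //; split; last by move=> /(_ _ uz).
by move=> w tw; apply: stu; right.
Qed.

(** If [z] lies in every ball containing [s], it lies in the unit ball about each vertex of each
    maximal clique [t] of the family; maximality then puts [z] in [t]. *)
Lemma max_clique_meet s : max_clique_intersections X s -> round_cliques X s.
Proof.
move=> [s0 [F [[t0 Ft0] Fmax sE]]]; apply/round_cliqueP; split.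
  have [[_ ct] _] := Fmax _ Ft0; split=> // x y; rewrite sE.
  by move=> /(_ _ Ft0) tx /(_ _ Ft0); exact: ct.
move=> z hz; rewrite sE => t Ft; have [ct tmax] := Fmax _ Ft.
have [_ ct1] := (cliqueE conn t).1 ct.
have tz w : t w -> gdist w z <= 1.
  by move=> tw; apply: (hz w 1) => u; rewrite sE => /(_ _ Ft) tu; exact: ct1.
suff <- : t `|` [set z] = t by right.
apply: tmax; last exact: subsetUl.
apply/(cliqueE conn); split; first by exists z; right.
move=> x y [tx|->] [ty|->]; rewrite ?gdistxx//; first exact: ct1.
- exact: tz.
- by rewrite gdistC//; exact: tz.
Qed.

Lemma round_clique_separate s w : round_cliques X s ->
    (forall x, s <> [set x]) -> ~ s w ->
  exists2 t, max_clique t & s `<=` t /\ ~ t w.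
Proof.
move=> rs ns nsw; have [cs rs'] := (round_cliqueP s).1 rs.
have [[u su] cs1] := (cliqueE conn s).1 cs.
(* A maximal clique containing [s] and such a [z] cannot contain [w]. *)
suff [z sz zw] : exists2 z, (forall u, s u -> gdist u z <= 1) & 1 < gdist z w.
  have [|t tmax st] := @max_clique_ex (s `|` [set z]).
    apply/(cliqueE conn); split; first by exists z; right.
    move=> x y [sx|->] [sy|->]; rewrite ?gdistxx//; first exact: cs1.
      exact: sz.
    by rewrite gdistC//; exact: sz.
  exists t => //; split=> [v sv|tw]; first by apply: st; left.
  have [/(cliqueE conn)[_ ct] _] := tmax.
  by have := ct z w (st _ (or_intror erefl)) tw; lia.
have [[z sz zw]|no] := pselect (exists2 z, s z & 1 < gdist z w).
  by exists z => // v sv; exact: cs1.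
have near z : s z -> gdist z w <= 1.
  by move=> sz; rewrite leqNgt; apply/negP => zw; apply: no; exists z.
have [x [r [sxr xw]]] : exists x r, s `<=` gball x r /\ r < gdist x w.
  apply: contrapT => h; apply: nsw; apply: rs' => x r sxr.
  rewrite /gball /= leqNgt; apply/negP => xw; apply: h.
  by exists x, r.
have sx z : s z -> gdist x z = r.
  move=> sz; have := sxr _ sz; have := near _ sz; rewrite /gball /=.
  by have := gdist_triangle conn z x w; lia.
(* Radius 0 would make [s] a singleton; positivity makes [r.-1] a true decrease. *)
have r0 : 0 < r.
  rewrite lt0n; apply/eqP => r0; apply: (ns u); apply/seteqP; split=> [v sv|_ -> //].
  have := sx _ sv; have := sx _ su; rewrite r0.
  by move=> /(gdist0_eq conn) <- /(gdist0_eq conn).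
have [|z hz] := @helly_point (fun v k => s v /\ k = 1 \/ v = x /\ k = r.-1).
  move=> v k v' k' [[sv ->]|[-> ->]] [[sv' ->]|[-> ->]].
  - by rewrite (leq_trans (cs1 _ _ sv sv')).
  - by rewrite gdistC// sx//; lia.
  - by rewrite sx//; lia.
  - by rewrite gdistxx.
exists z; first by move=> v sv; apply: hz; left.
have : gdist x z <= r.-1 by apply: hz; right.
by have := gdist_triangle conn z x w; lia.
Qed.

Lemma round_cliquesE :
  round_cliques X = [set [set x] | x in [set: X]] `|` max_clique_intersections X.
Proof.
apply/seteqP; split=> s; last first.
  by case=> [[x _ <-]|]; [exact: round_clique1|exact: max_clique_meet].
move=> rs; have [[x ->]|ns] := pselect (exists x, s = [set x]); first by left; exists x.
right; have [cs _] := (round_cliqueP s).1 rs; split; first by case: cs.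
exists [set t | max_clique t /\ s `<=` t]; split.
- by have [t tm st] := max_clique_ex cs; exists t.
- by move=> t [].
apply/seteqP; split=> [z sz t [_]|z hz]; first exact.
apply: contrapT => nsz.
have [|t tm [st]] := round_clique_separate rs _ nsz.
  by move=> x sx; apply: ns; exists x.
by apply; apply: hz.
Qed.

End Helly.

(** * From natural-valued functions to the real injective hull *)

Lemma sup_max_eq (R : realType) (A : set R) m : A m -> ubound A m -> sup A = m.
Proof.
move=> Am ub; apply/le_anti/andP; split; first by apply: ge_sup => //; exists m.
by apply: ub_le_sup => //; exists m.
Qed.

Lemma dist_halfE (R : realType) (m n : nat) :
  (`|m%:R / 2 - n%:R / 2 : R| <= 2^-1) = (m <= n.+1)%N && (n <= m.+1)%N.
Proof.
rewrite ler_distl -!(ler_nat R) -[m.+1%:R]natr1 -[n.+1%:R]natr1.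
by apply/andP/andP => -[h1 h2]; split; lra.
Qed.

Section Subdivision.
Variables (R : realType) (X : graph).
Hypothesis hX : helly_graph X.
Implicit Types (x y z : X) (F G : X -> nat).

Let conn : connected_graph X := proj1 hX.

Definition halved F : X -> R := fun x => (F x)%:R / 2.

Lemma halved_inj F G : halved F = halved G -> F = G.
Proof.
move=> FG; apply/funext => x; have FGx : halved F x = halved G x by rewrite FG.
by apply/eqP; rewrite -(eqr_nat R); apply/eqP; move: FGx; rewrite /halved; lra.
Qed.

Lemma subdivisionP (f : X -> R) :
  (@injective_hull R X `&` @half_integral R X) f <->
  exists2 F, half_hull F & f = halved F.
Proof.
split=> [[[h1 h2] /choice[F fF]]|[F [h1 h2] ->]].
  exists F; last exact/funext.
  have h x y : (2 * gdist x y <= F x + F y)%N.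
    by have := h1 x y; rewrite !fF -(ler_nat R) natrM natrD; lra.
  split=> // x; apply: contrapT => /forallNP no.
  (* If no [y] is antipodal to [x], half-integrality keeps every [d(x, y) - f y] at least 1/2 below
     [f x], and so their supremum. *)
  have : f x <= f x - 2^-1.
    rewrite {1}h2; apply: ge_sup; first by exists ((gdist x x)%:R - f x); exists x.
    move=> _ [y _ <-]; have : (2 * gdist x y < F x + F y)%N.
      by have := no y; have := h x y; lia.
    by rewrite !fF -(ler_nat R) -natr1 natrM natrD; lra.
  lra.
split; last by move=> x; exists (F x).
have h x y : (gdist x y)%:R <= halved F x + halved F y.
  by have := h1 x y; rewrite /halved -(ler_nat R) natrM natrD; lra.
split=> // x; apply/esym/sup_max_eq; last first.
  by move=> _ [y _ <-]; have := h x y; lra.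
have [y xy] := h2 x; exists y => //.
have /(congr1 (fun n => n%:R : R)) := xy.
by rewrite /halved natrM natrD; lra.
Qed.

Lemma kuratowskiE x : kuratowski R x = halved (fun y => 2 * gdist x y)%N.
Proof. by apply/funext => y; rewrite /halved /kuratowski natrM; lra. Qed.

(** The supremum is attained at [x]; elsewhere the Lipschitz bound and the hull inequality give the
    two sides of the estimate. *)
Lemma dinf_kuratowski F x :
  half_hull F -> dinf (halved F) (kuratowski R x) = halved F x.
Proof.
move=> hF; apply: sup_max_eq.
  exists x => //; rewrite /kuratowski gdistxx// subr0 ger0_norm//.
  by rewrite /halved divr_ge0.
move=> _ [y _ <-]; have [h1 _] := hF.
have := h1 x y; have := half_hull_lip hX y x hF.
rewrite -!(ler_nat R) !natrM !natrD /halved /kuratowski ler_distl => *.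
by apply/andP; split; lra.
Qed.

Lemma coreE F : half_hull F ->
  core F = [set x | dinf (halved F) (kuratowski R x) <= 2^-1].
Proof.
move=> hF; apply/seteqP; split=> x /=; rewrite dinf_kuratowski// /halved /core /=;
  by rewrite -(ler_nat R); lra.
Qed.

Lemma dinf_halved F G : dinf (halved F) (halved G) = 2^-1 <->
  F <> G /\ forall y, (F y <= (G y).+1 /\ G y <= (F y).+1)%N.
Proof.
have half0 : (0 : R) <> 2^-1 by move=> h; lra.
split=> [FG|[FG close]].
  split=> [FG'|y].
    apply: half0; rewrite -FG FG'; apply/esym/sup_max_eq.
      by case: conn => -[x _] _; exists x => //; rewrite subrr normr0.
    by move=> _ [y _ <-]; rewrite subrr normr0.
  suff /andP[] : (F y <= (G y).+1)%N && (G y <= (F y).+1)%N by [].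
  rewrite -(dist_halfE R) -[leRHS]FG; apply: sup_upper_bound; last by exists y.
  (* Without a genuine supremum, [sup] would take its default value 0 instead of 1/2. *)
  by apply: contrapT => /sup_out h; apply: half0; rewrite -FG -h.
have ub y : `|halved F y - halved G y| <= 2^-1.
  by rewrite dist_halfE; have [-> ->] := close y.
apply: sup_max_eq; last by move=> _ [y _ <-]; exact: ub.
have [y FGy] : exists y, F y <> G y.
  by apply: contrapT => /forallNP h; apply/FG/funext => y; exact: contrapT (h y).
exists y => //; have [c1 c2] := close y; rewrite /halved.
have [e|e] : F y = (G y).+1 \/ G y = (F y).+1 by lia.
  by rewrite e -[(G y).+1%:R]natr1 ger0_norm; lra.
by rewrite e -[(F y).+1%:R]natr1 ler0_norm; lra.
Qed.

End Subdivision.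

(** * The isomorphism and the doubling of distances *)

Theorem theorem4p4 (R : realType) (X : graph) (hX : helly_graph X) :
  round_cliques X
    = [set [set x] | x in [set: X]] `|` max_clique_intersections X /\
  exists (iota : X -> helly_subdivision R X)
         (phi : helly_subdivision R X -> round_clique_graph X),
    [/\ (forall x, \val (iota x) = kuratowski R x),
        (forall x y, gdist (iota x) (iota y) = (2 * gdist x y)%N),
        graph_iso phi,
        (forall f, \val (phi f)
                   = [set x | dinf (\val f) (kuratowski R x) <= 2^-1]) &
        (forall x, \val (phi (iota x)) = [set x]) /\
        (forall a : X -> X, graph_iso a ->
           forall f g : helly_subdivision R X, \val g = \val f \o a ->
             \val (phi g) = a @^-1` \val (phi f))].
Proof.
split; first exact: round_cliquesE.
have conn : connected_graph X := proj1 hX.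
have mk F : half_hull F -> exists f : helly_subdivision R X, \val f = halved R F.
  move=> hF; have /mem_set Ff : (@injective_hull R X `&` @half_integral R X) (halved R F).
    by apply/subdivisionP; exists F.
  by exists (SigSub Ff).
have /choice[D hD] (f : helly_subdivision R X) :
    exists F, half_hull F /\ \val f = halved R F.
  by have /set_mem/subdivisionP[F ? ?] := valP f; exists F.
have D_eq f F : \val f = halved R F -> D f = F.
  by have [_ ->] := hD f; exact: halved_inj.
have D_inj f g : D f = D g -> f = g.
  by move=> fg; apply: val_inj; rewrite (hD f).2 (hD g).2 fg.
have /choice[phi phiE] (f : helly_subdivision R X) :
    exists s : round_clique_graph X, \val s = core (D f).
  have /mem_set rs : round_cliques X (core (D f)) by apply: core_round => //; exact: (hD f).1.
  by exists (SigSub rs).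
have phi_dinf f : \val (phi f) = [set x | dinf (\val f) (kuratowski R x) <= 2^-1].
  by have [hf ->] := hD f; rewrite phiE (coreE R).
have phi_inj : injective phi.
  move=> f g fg; apply: D_inj; have sf := core_spread hX (hD f).1.
  have := core_spread hX (hD g).1; rewrite -phiE -fg phiE.
  exact: spread_inj.
have phi_surj s : exists f, phi f = s.
  have /set_mem rs := valP s; have [cs _] := (round_cliqueP _).1 rs.
  have [F Fs] := clique_spread hX cs.
  have [f fF] := mk F (spread_half_hull hX rs Fs).
  by exists f; apply: val_inj; rewrite phiE (D_eq _ _ fF); exact: spread_core.
have adjP f g : adj f g <->
    D f <> D g /\ forall y, (D f y <= (D g y).+1 /\ D g y <= (D f y).+1)%N.
  rewrite -(dinf_halved R hX) -(hD f).2 -(hD g).2.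
  by split=> [/eqP//|h]; apply/eqP.
have phi_adj f g : adj (phi f) (phi g) = adj f g.
  apply/asboolP/idP => [[ne fg cfg]|/adjP[ne]].
    apply/adjP; split=> [/D_inj e|]; first by apply: ne; rewrite e.
    by apply/(half_hull_close hX (hD f).1 (hD g).1); rewrite -!phiE.
  move=> /(half_hull_close hX (hD f).1 (hD g).1); rewrite -!phiE => -[]; split=> //.
  by move=> /phi_inj e; apply: ne; rewrite e.
have /choice[iota iotaE] x : exists f : helly_subdivision R X, \val f = kuratowski R x.
  have [f fE] := mk _ (half_hull_gdist hX x).
  by exists f; rewrite kuratowskiE.
have D_iota x : D (iota x) = (fun y => 2 * gdist x y)%N.
  by apply: D_eq; rewrite iotaE kuratowskiE.
have phi_iota x : \val (phi (iota x)) = [set x] by rewrite phiE D_iota core_gdist.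
have phi_iso : graph_iso phi.
  split=> //; have [psi psiK] := choice phi_surj.
  by exists psi => // f; apply: phi_inj; rewrite psiK.
exists iota, phi; split=> //; last first.
- split=> // a _ f g fg; rewrite !phiE (D_eq g (D f \o a))//.
  by rewrite fg (hD f).2.
move=> x y; apply: gdist_eq.
  (* Upper bound: each edge of a shortest walk is replaced by two edges through a midpoint [f],
     whose round clique contains both ends. *)
  have [_ /(_ x y)[n /walk_gdist]] := conn.
  elim: {n}(gdist x y) {2 4}x => [|n IH] {}x; first by move=> /walk0_eq ->; exact: walk0.
  rewrite -add1n mulnDr => /walk_split[z xz /IH]; apply: walk_cat.
  have {}xz := adj_walk1 xz; have ne : x <> z by move=> e; rewrite e adj_irr in xz.
  have [s [rs sx sz]] := round_clique_edge hX ((gdist_le1 conn x z).1 (fun=> xz)).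
  have [f fs] := phi_surj (SigSub (mem_set rs)).
  have fsE : \val (phi f) = s by rewrite fs.
  have [cs _] := (round_cliqueP _).1 rs.
  (* The second vertex [w'] of [s] ensures that [f] differs from [iota w]. *)
  have near w w' : s w -> s w' -> w <> w' -> adj (iota w) f.
    move=> sw sw' ww'; rewrite -phi_adj; apply/asboolP; split.
    - move=> e; apply: ww'; have : s w' by []; rewrite -fsE -e phi_iota => ->//.
    - by exists w; rewrite phi_iota fsE.
    - rewrite phi_iota fsE (_ : _ `|` _ = s)//.
      by apply/setUidPr => _ ->.
  apply: (@walk_cat _ 1 1 _ f); apply: walk1; first exact: (near x z).
  by rewrite adj_sym; apply: (near z x) => // /esym.
(* Lower bound: along an edge [D] changes by at most 1 at each vertex, and at [y] it must fall from
   [2 d(x, y)] to 0. *)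
move=> n; suff h f g : walk n f g -> forall z, (D f z <= D g z + n)%N.
  by move=> /h/(_ y); rewrite !D_iota gdistxx//.
elim: n f => [|n IH] f; first by move=> /walk0_eq -> z; rewrite addn0.
rewrite -{1}add1n => /walk_split[h fh /IH hg] z.
by move: (adj_walk1 fh) => /adjP[_ /(_ z)]; have := hg z; lia.
Qed.
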